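(* Let $V$ be a vector space of dimension $n$ over a finite field of size $q$. Let $K=\{k_1,\ldots,k_r\}$ and $L=\{\mu_1,\ldots,\mu_s\}$ be two disjoint subsets of $\{0,1,\ldots,b-1\}$ with $k_1<\cdots<k_r$. Assume $s+k_r\le n$ and $r(s-r+1)\le b-1$. Let $\mathcal{F}=\{V_1,\ldots,V_m\}$ be a family of subspaces of $V$ such that for all $i\in[m]$, $\dim(V_i)\equiv k_t\pmod b$ for some $k_t\in K$, and for every distinct $i,j\in[m]$, $\dim(V_i\cap V_j)\equiv\mu_t\pmod b$ for some $\mu_t\in L$. Assume neither (i) $q+1$ is a power of $2$ and $b=2$, nor (ii) $q=2$ and $b=6$. Then $|\mathcal{F}|\le N(n,s,r,q)$.
   Context: $\binom{a}{d}_q$ denotes the $q$-binomial coefficient (number of $d$-dimensional subspaces of an $a$-dimensional space over $\mathbb{F}_q$), zero if $d<0$ or $d>a$. $N(n,s,r,q):=\binom{n}{s}_q+\binom{n}{s-1}_q+\cdots+\binom{n}{s-r+1}_q$. *)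

(* Defs.v *)
From HB Require Import structures.
From mathcomp Require Import all_boot all_order all_algebra.

Set Implicit Arguments.
Unset Strict Implicit.
Unset Printing Implicit Defensive.

Import Order.TTheory GRing.Theory Num.Theory.

Local Open Scope ring_scope.

(* Gives access to the subType structure of {vspace V}. *)
Import VectorInternalTheory.

(* Over a finite field the subspaces of V form a finite type; the library only
   provides the choice structure. *)
HB.instance Definition _ (F : finFieldType) (V : vectType F) :=
  [Countable of {vspace V} by <:].
HB.instance Definition _ (F : finFieldType) (V : vectType F) :=
  [Finite of {vspace V} by <:].

(* The q-binomial coefficient with q = #|F|. The lower index is an int, so that
   the value is 0 for d < 0, as it is for d > a. *)
Definition qbinom (F : finFieldType) (a : nat) (d : int) : nat :=
  #|[set U : {vspace 'rV[F]_a} | (\dim U)%:Z == d]|.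

(* The terms are those with lower index s, s - 1, ..., s - r + 1. *)
Definition Nqsum (F : finFieldType) (n s r : nat) : nat :=
  (\sum_(i < r) qbinom F n (s%:Z - i%:Z)%R)%N.

(* d is congruent modulo b to an element of A, a set of residues in
   {0, ..., b - 1}. *)
Definition mod_in (b : nat) (A : {set 'I_b}) (d : nat) : Prop :=
  exists2 k : 'I_b, k \in A & d = k %[mod b].

(* Main.v *)
Require Import Defs.
From mathcomp Require Import all_boot all_order all_algebra all_field.
From mathcomp Require Import zify.

(* By Zsigmondy's theorem there is a prime p modulo which q has multiplicative
   order b, so that q ^ x mod p determines x mod b; (i) and (ii) are the exceptions
   of that theorem for b > 1, and b = 1 is trivial. Over F_p, consider the functions on
   subspaces U
     f_i(U) = \prod_(l in L) (q ^ dim (U :&: V_i) - q ^ l),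
     g_M(U) = [M <= U] * \prod_(k in K) (q ^ dim U - q ^ k), dim M <= s - r.
   All of them lie in the span of the indicators [M <= U] with dim M <= s. They
   are linearly independent: the g_M vanish at the V_j, where the f_i are
   diagonal with nonzero entries; and a relation \sum_M c_M g_M = 0 forces \sum_(M <= U) c_M = 0
   whenever dim U is in none of the classes of K. As r(s - r + 1) < b, this holds
   for all U in s - r + 1 consecutive dimensions, and Moebius inversion in the
   subspace lattice propagates it downwards until c = 0. Hence
   |F| + #{dim <= s - r} <= #{dim <= s}. *)

Import Order.TTheory GRing.Theory Num.Theory.
Local Open Scope ring_scope.

Set Implicit Arguments.
Unset Strict Implicit.
Unset Printing Implicit Defensive.

(** * Primitive prime divisors *)

Definition cyclotomic_value (n q : nat) : nat := `|('Phi_n).[q%:Z]|%N.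

Lemma norm_prim_root (n : nat) (z : algC) : n.-primitive_root z -> `|z| = 1.
Proof.
move=> zn; have n0 := prim_order_gt0 zn.
apply/eqP; rewrite -(pexpr_eq1 n0) ?normr_ge0 // -normrX.
by rewrite (prim_expr_order zn) normr1.
Qed.

Lemma cyclotomic_valueE (n q : nat) (z : algC) : n.-primitive_root z ->
  (cyclotomic_value n q)%:R = \prod_(k < n | coprime k n) `|q%:R - z ^+ k|.
Proof.
move=> zn; rewrite -normr_prod.
have -> : \prod_(k < n | coprime k n) (q%:R - z ^+ k) =
    (map_poly intr 'Phi_n).[q%:Z%:~R].
  rewrite (Cintr_Cyclotomic zn) /cyclotomic horner_prod.
  by apply: eq_bigr => k _; rewrite hornerXsubC.
by rewrite horner_map /= /cyclotomic_value natr_absz -intr_norm.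
Qed.

(** Over the complex numbers the value is a product of [totient n] factors [|q - z ^ k|], each
    controlled by the triangle inequality. *)
Lemma cyclotomic_value_bounds (n q : nat) : (0 < n)%N -> (0 < q)%N ->
  ((q - 1) ^ totient n <= cyclotomic_value n q <= (q + 1) ^ totient n)%N.
Proof.
move=> n0 q0; have [z zn] := C_prim_root_exists n0.
have nz k : `|z ^+ k| = 1 by rewrite normrX (norm_prim_root zn) expr1n.
have ct x : x ^+ totient n = \prod_(k < n | coprime k n) x :> algC.
  rewrite prodr_const; congr (_ ^+ _).
  transitivity (\sum_(k < n | coprime k n) 1)%N; last by rewrite sum1_card.
  rewrite totient_count_coprime big_mkord [RHS]big_mkcond /=.
  by apply: eq_bigr => k _; rewrite coprime_sym; case: coprime.
rewrite -!(ler_nat algC) !natrX (cyclotomic_valueE _ zn) !ct.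
apply/andP; split; apply: ler_prod => k _; rewrite ?normr_ge0 ?ler0n /=.
  by have := lerB_dist (q%:R : algC) (z ^+ k); rewrite natrB // normr_nat nz.
by have := ler_normB (q%:R : algC) (z ^+ k); rewrite natrD normr_nat nz.
Qed.

(** At [q = 2] the bound [(q - 1) ^ totient n] is only 1, so the factor at [z] itself is shown to
    exceed 1. *)
Lemma cyclotomic_value_gt1 (n q : nat) : (1 < n)%N -> (1 < q)%N ->
  (1 < cyclotomic_value n q)%N.
Proof.
move=> n1 q1; have [z zn] := C_prim_root_exists (ltnW n1).
have z1 := norm_prim_root zn.
have ge1 k : 1 <= `|q%:R - z ^+ k|.
  have := lerB_dist (q%:R : algC) (z ^+ k).
  rewrite normrX z1 expr1n normr_nat; apply: le_trans.
  by rewrite lerBrDl -(natrD _ 1 1) ler_nat.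
rewrite -(ltr_nat algC) (cyclotomic_valueE _ zn).
rewrite (bigD1 (Ordinal n1)) /= ?coprime1n // expr1.
apply: (@lt_le_trans _ _ `|q%:R - z|).
  have := ge1 1%N; rewrite expr1 le_eqVlt => /predU1P[eq1|//].
  have qE : `|q%:R : algC| - `|z| = 1.
    apply/eqP; rewrite normr_nat z1 subr_eq -(natrD _ 1 1) eqr_nat.
    rewrite eqn_leq q1 andbT -(ler_nat algC) (natrD _ 1 1).
    have := lerB_dist (q%:R : algC) z.
    by rewrite -eq1 normr_nat z1 lerBlDr.
  (* Equality in the triangle inequality makes [q] and [z] nonnegative multiples of one unit [t];
     this forces [z = 1], against [1 < n]. *)
  have [t _ [qt zt]] := normCBeq (etrans (esym eq1) (esym qE)).
  have t1 : t = 1.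
    apply: (@mulfI _ (q%:R : algC)); first by rewrite pnatr_eq0 -lt0n ltnW.
    by rewrite mulr1 {2}qt normr_nat.
  move: zt; rewrite t1 z1 mulr1 => zE.
  have := prim_order_dvd zn 1; rewrite expr1 zE eqxx dvdn1.
  by rewrite gtn_eqF.
rewrite ler_peMr ?normr_ge0 //.
by elim/big_ind: _ => // x y; exact: mulr_ege1.
Qed.

(** The sum is [(X^n - 1) / (X^(n/l) - 1)], and ['Phi_n] survives in the quotient because [n] does
    not divide [n / l]. *)
Lemma cyclotomic_dvd_geometric (n l : nat) : (0 < n)%N -> (1 < l)%N -> (l %| n)%N ->
  exists G : {poly int}, 'Phi_n * G = \sum_(i < l) ('X^(n %/ l)) ^+ i.
Proof.
move=> n0 l1 ln; set m := (n %/ l)%N.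
have nE : n = (m * l)%N by rewrite divnK.
have m0 : (0 < m)%N by move: n0; rewrite nE muln_gt0 => /andP[].
have mn : (m < n)%N by rewrite nE ltn_Pmulr.
pose G : {poly int} := \prod_(d <- divisors n | (~~ (d %| m)%N) && (d != n)) 'Phi_d.
exists G; apply: (@mulfI _ ('X^m - 1)).
  by rewrite -size_poly_eq0 size_XnsubC.
rewrite -subrX1 -exprM -nE -(prod_Cyclotomic n0) -(prod_Cyclotomic m0).
rewrite [RHS](bigID (fun d => (d %| m)%N)) /=; congr (_ * _).
  rewrite -[RHS]big_filter; apply: perm_big; apply: uniq_perm.
  - exact: divisors_uniq.
  - by rewrite filter_uniq // divisors_uniq.
  move=> d; rewrite mem_filter -!dvdn_divisors //.
  by case: (boolP (d %| m)%N) => // dm; rewrite nE dvdn_mulr.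
rewrite -[RHS]big_filter (bigD1_seq n) ?filter_uniq ?divisors_uniq //=.
  by rewrite big_filter_cond.
rewrite mem_filter -dvdn_divisors // dvdnn andbT.
by apply: contraTN mn => /(dvdn_leq m0); rewrite leqNgt.
Qed.

Lemma cyclotomic_value_dvd (n l q : nat) :
    (0 < n)%N -> (1 < l)%N -> (l %| n)%N ->
  (cyclotomic_value n q %| \sum_(i < l) (q ^ (n %/ l)) ^ i)%N.
Proof.
move=> n0 l1 ln; have [G eqG] := cyclotomic_dvd_geometric n0 l1 ln.
apply/dvdnP; exists `|G.[q%:Z]|%N; rewrite mulnC -abszM -hornerM eqG.
rewrite -[LHS]absz_nat; congr absz.
rewrite horner_sum -natz natr_sum; apply: eq_bigr => i _.
by rewrite !natrX natz !hornerE.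
Qed.

(** Let [m] be the order of [q] modulo [p]. For a prime [l] dividing [n / m], the geometric sum in
    [q ^ (n / l) = 1] equals [l] and vanishes modulo [p], so [l = p]. Hence [n / m] is a power of
    [p]; Fermat gives that [m] divides [p - 1]. *)
Lemma cyclotomic_prime_cases (n q p : nat) :
    (1 < n)%N -> prime p -> (p %| cyclotomic_value n q)%N ->
  n.-primitive_root (q%:R : 'F_p) \/
  exists m k, [/\ n = (m * p ^ k.+1)%N, (m %| p.-1)%N
    & m.-primitive_root (q%:R : 'F_p)].
Proof.
move=> n1 pp pN; have n0 : (0 < n)%N by exact: ltnW.
have charp := pchar_Fp pp.
have geom0 l : (1 < l)%N -> (l %| n)%N ->
    \sum_(i < l) (q%:R ^+ (n %/ l)) ^+ i = 0 :> 'F_p.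
  move=> l1 ln; apply/eqP.
  have := dvdn_trans pN (cyclotomic_value_dvd q n0 l1 ln).
  rewrite (dvdn_pcharf charp) natr_sum; congr (_ == _).
  by apply: eq_bigr => i _; rewrite !natrX.
have qn1 : q%:R ^+ n = 1 :> 'F_p.
  apply/eqP; rewrite -subr_eq0 subrX1.
  have := geom0 n n1 (dvdnn n); rewrite divnn n0 expr1 => ->.
  by rewrite mulr0.
have [m mp mn] := prim_order_exists n0 qn1.
have m0 := prim_order_gt0 mp.
have [mnE|mNn] := eqVneq m n; first by left; rewrite -mnE.
right; have nE := divnK mn; set d := (n %/ m)%N in nE.
have d0 : (0 < d)%N by rewrite divn_gt0 // dvdn_leq.
have dp : p.-nat d.
  apply/pnatP => // l lp ld; rewrite inE.
  have ln : (l %| n)%N by rewrite -nE dvdn_mulr.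
  have := geom0 l (prime_gt1 lp) ln.
  have -> : q%:R ^+ (n %/ l) = 1 :> 'F_p.
    apply/eqP; rewrite -(prim_order_dvd mp) -nE -divn_mulAC //.
    by rewrite dvdn_mull.
  rewrite (eq_bigr (fun=> 1)) => [|i _]; last by rewrite expr1n.
  rewrite sumr_const card_ord => /eqP; rewrite -(dvdn_pcharf charp).
  by rewrite dvdn_prime2 // eq_sym.
have [[|k] dE] := p_natP dp.
  by move: mNn; rewrite -nE dE mul1n eqxx.
exists m, k; split; rewrite -?dE ?[(m * _)%N]mulnC //.
rewrite (prim_order_dvd mp).
have q0 : q%:R != 0 :> 'F_p.
  apply: contra_eqN qn1 => /eqP->.
  by rewrite expr0n eqn0Ngt n0 eq_sym oner_eq0.
apply/eqP/(mulfI q0); rewrite -exprS prednK ?prime_gt0 // mulr1.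
by have := expf_card (q%:R : 'F_p); rewrite card_Fp.
Qed.

(** With [x = 1 + p * y] the sum is [p + p * y * 'C(p, 2)] modulo [p ^ 2], and [p] divides
    ['C(p, 2)] because [p] is odd. *)
Lemma odd_prime_sq_ndvd_geometric (p x : nat) : prime p -> (2 < p)%N ->
  x = 1 %[mod p] -> ~~ (p ^ 2 %| \sum_(i < p) x ^ i)%N.
Proof.
move=> pp p2 x1; have p0 := prime_gt0 pp.
have xE : x = (1 + p * (x %/ p))%N.
  by rewrite {1}(divn_eq x p) x1 modn_small ?prime_gt1 // mulnC addnC.
set y := (x %/ p)%N in xE.
have xiE i : x ^ i = 1 + i * (p * y) %[mod p ^ 2].
  elim: i => [|i IH]; first by rewrite expn0.
  rewrite expnS -modnMmr IH modnMmr xE.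
  have -> : ((1 + p * y) * (1 + i * (p * y)) =
      (1 + i.+1 * (p * y)) + i * y * y * p ^ 2)%N by nia.
  by rewrite addnC modnMDl.
have sE : \sum_(i < p) x ^ i = p + p * y * 'C(p, 2) %[mod p ^ 2].
  rewrite -modn_summ; under eq_bigr do rewrite xiE; rewrite modn_summ.
  rewrite big_split /= sum_nat_const card_ord muln1 -big_distrl /=.
  by rewrite -bin2_sum big_mkord [(_ * (p * y))%N]mulnC.
rewrite /dvdn sE -/(dvdn _ _) dvdn_addl.
  by rewrite -{2}[p]expn1 dvdn_Pexp2l // prime_gt1.
by rewrite -mulnA expnS expn1 dvdn_pmul2l // dvdn_mull // prime_dvd_bin.
Qed.

(** The value divides a geometric sum of [p] terms whose ratio [q ^ (n / p)] is 1 modulo [p]. *)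
Lemma prime_sq_ndvd_cyclotomic_value (m k q p : nat) :
    prime p -> (2 < m * p ^ k.+1)%N -> (m %| p.-1)%N ->
    m.-primitive_root (q%:R : 'F_p) ->
  ~~ (p ^ 2 %| cyclotomic_value (m * p ^ k.+1) q)%N.
Proof.
move=> pp n2 mp1 mp; have p0 := prime_gt0 pp.
set n := (m * p ^ k.+1)%N in n2 *.
have nE : (n %/ p = m * p ^ k)%N by rewrite /n expnSr mulnA mulnK.
have pn : (p %| n)%N by rewrite /n expnSr mulnA dvdn_mull.
have n0 : (0 < n)%N by apply: leq_trans n2.
have := cyclotomic_value_dvd q n0 (prime_gt1 pp) pn; rewrite nE => Nd.
have x1 : q ^ (m * p ^ k) = 1 %[mod p].
  rewrite -!(val_Fp_nat pp); congr nat_of_ord.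
  by rewrite natrX exprM (prim_expr_order mp) expr1n.
apply: contraL Nd => p2N.
suff: ~~ (p ^ 2 %| \sum_(i < p) (q ^ (m * p ^ k)) ^ i)%N.
  by apply: contraNN; exact: dvdn_trans.
have [p3|] := ltnP 2 p; first exact: odd_prime_sq_ndvd_geometric.
rewrite leq_eqVlt ltnS leqNgt prime_gt1 // orbF => /eqP pE.
(* For [p = 2], [m = 1] and [2 < n] puts the exponent of 2 at two or more: the ratio is an odd
   square, so the two-term sum is 2 modulo 4. *)
move: mp1 n2 x1; rewrite /n pE dvdn1 => /eqP ->; rewrite !mul1n.
case: k {nE n n0 pn p2N} => [//|k] _ x1.
rewrite big_ord_recl big_ord1 expn0 expn1 (expnSr 2 k) expnM.
have oddx : odd (q ^ 2 ^ k).
  by rewrite oddX; move: x1; rewrite !modn2 oddX expn_eq0 /=; case: odd => //; rewrite orbT.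
rewrite -(odd_double_half (q ^ 2 ^ k)) oddx; set y := _./2.
have -> : (1 + (true + y.*2) ^ 2 = 2 + (y + y ^ 2) * 2 ^ 2)%N by rewrite -muln2 /=; nia.
by rewrite dvdn_addl // dvdn_mull.
Qed.

(* A non-primitive prime divisor of 'Phi_n(q) is the largest prime factor of n
   and its square does not divide 'Phi_n(q). *)
Lemma primitive_prime_or_small (n q : nat) : (2 < n)%N -> (1 < q)%N ->
  (exists p, prime p /\ n.-primitive_root (q%:R : 'F_p)) \/
    (exists p m k, [/\ prime p, n = (m * p ^ k.+1)%N, (m %| p.-1)%N,
        m.-primitive_root (q%:R : 'F_p) & cyclotomic_value n q = p]).
Proof.
move=> n2 q1; have n1 := ltnW n2; have := cyclotomic_value_gt1 n1 q1.
set N := cyclotomic_value n q => N1.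
have pp := pdiv_prime N1; set p := pdiv N in pp.
have pN : (p %| N)%N := pdiv_dvd N.
have [|[m [k [nE mp1 mp]]]] := cyclotomic_prime_cases n1 pp pN.
  by left; exists p.
have [N' NE] := dvdnP pN.
have [N'1|N'1] := leqP N' 1.
  right; exists p, m, k; split=> //.
  case: N' N'1 NE => [|[|//]] _ NE; last by rewrite NE mul1n.
  by rewrite NE in N1.
have pp' := pdiv_prime N'1; set p' := pdiv N' in pp'.
have pN' : (p' %| N)%N by rewrite NE dvdn_mulr // pdiv_dvd.
have [|[m' [k' [nE' mp1' mp']]]] := cyclotomic_prime_cases n1 pp' pN'.
  by left; exists p'.
have p'p : p' != p.
  have := prime_sq_ndvd_cyclotomic_value pp; rewrite nE in n2 NE.
  move=> /(_ _ _ _ n2 mp1 mp); apply: contraNneq => p'p.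
  rewrite -nE -/N [N]NE -mulnn dvdn_mul // -p'p; exact: pdiv_dvd.
(* Of two distinct non-primitive primes, each would divide the predecessor of the other and so be
   the smaller one. *)
have lt_of (a b c e : nat) : prime a -> prime b -> a != b -> (a %| c * b ^ e)%N ->
    (c %| b.-1)%N -> (a < b)%N.
  move=> pa pb ab; rewrite Euclid_dvdM // Euclid_dvdX // (dvdn_prime2 pa pb) (negPf ab) orbF.
  have b0 : (0 < b.-1)%N by rewrite -subn1 subn_gt0 prime_gt1.
  by move=> /dvdn_trans ac /ac /(dvdn_leq b0); rewrite -ltnS prednK ?prime_gt0.
have pn' : (p' %| m * p ^ k.+1)%N by rewrite -nE nE' expnS mulnCA dvdn_mulr.
have pn : (p %| m' * p' ^ k'.+1)%N by rewrite -nE' nE expnS mulnCA dvdn_mulr.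
have := lt_of _ _ _ _ pp' pp p'p pn' mp1.
rewrite ltnNge ltnW // (lt_of _ _ _ _ pp pp' _ pn mp1') //.
by rewrite eq_sym.
Qed.

Lemma totient_ge_pred_prime (m p k : nat) : prime p -> (0 < m)%N ->
  (m %| p.-1)%N -> (p.-1 <= totient (m * p ^ k.+1))%N.
Proof.
move=> pp m0 mp; have p1 : (0 < p.-1)%N by rewrite -subn1 subn_gt0 prime_gt1.
rewrite totient_coprime; last first.
  rewrite coprimeXr // coprime_sym prime_coprime //.
  apply/negP => /dvdn_trans /(_ mp) /(dvdn_leq p1).
  by rewrite leqNgt -[(_ < p)%N]/(p.-1.+1 <= p)%N prednK ?leqnn // prime_gt0.
rewrite totient_pfactor // mulnCA leq_pmulr // muln_gt0 totient_gt0 m0.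
by rewrite expn_gt0 prime_gt0.
Qed.

(** Otherwise ['Phi_n(q)] is a prime [p] with [p - 1 <= totient n]. It is also at least
    [2 ^ totient n], which exceeds [p]: for [p > 2] by [p < 2 ^ (p - 1)], for [p = 2] by
    [totient n >= 2]. *)
Lemma primitive_prime_gt2 (n q : nat) : (2 < n)%N -> (2 < q)%N ->
  exists p, prime p /\ n.-primitive_root (q%:R : 'F_p).
Proof.
move=> n2 q2; have n0 : (0 < n)%N by apply: leq_trans n2.
have /andP[Nge _] := cyclotomic_value_bounds n0 (ltnW (ltnW q2)).
have phi2 : (1 < totient n)%N by rewrite totient_gt1.
have Nge' : (2 ^ totient n <= cyclotomic_value n q)%N.
  apply: leq_trans Nge; rewrite leq_exp2r; last exact: ltnW phi2.
  by rewrite subn1 -ltnS (ltn_predK q2).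
have [//|[p [m [k [pp nE mp1 mp NE]]]]] := primitive_prime_or_small n2 (ltnW q2).
have := totient_ge_pred_prime k pp (prim_order_gt0 mp) mp1; rewrite -nE => phip.
have [p3|p3] := leqP p 2.
  have: (2 ^ 2 <= p)%N by rewrite -NE; apply: leq_trans Nge'; rewrite leq_exp2l.
  by rewrite leqNgt ltnS (leq_trans p3).
have: (2 ^ p.-1 <= p)%N.
  by rewrite -[leqRHS]NE; apply: leq_trans Nge'; rewrite leq_exp2l.
case: p p3 {pp NE mp1 mp nE phip} => // p p3 /=.
rewrite leqNgt; case/negP; elim: p p3 => // p IH.
rewrite ltnS leq_eqVlt => /predU1P[<- //|p2].
by rewrite expnS; have := IH p2; lia.
Qed.

(** * The base [q = 2] and the index [n = 2] *)

Lemma divisors_mul_prime (m p : nat) : prime p -> (0 < m)%N -> coprime m p ->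
  perm_eq (divisors (m * p)) (divisors m ++ [seq (d * p)%N | d <- divisors m]).
Proof.
move=> pp m0 mp; have p0 := prime_gt0 pp.
have mp0 : (0 < m * p)%N by rewrite muln_gt0 m0.
apply: uniq_perm; first exact: divisors_uniq.
  rewrite cat_uniq divisors_uniq map_inj_uniq ?divisors_uniq ?andbT /=; last first.
    by move=> x y /eqP; rewrite eqn_pmul2r // => /eqP.
  apply/hasPn => _ /mapP[d _ ->] /=; rewrite -dvdn_divisors //.
  apply: contraL mp => /(dvdn_trans (dvdn_mull d (dvdnn p))) pm.
  by rewrite coprime_sym prime_coprime // pm.
move=> d; rewrite mem_cat -!dvdn_divisors //; apply/idP/orP => [dmp|].
  have [/dvdnP[e dE]|pd] := boolP (p %| d)%N; [right|left].
    apply/mapP; exists e => //; move: dmp.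
    by rewrite dE dvdn_pmul2r // -dvdn_divisors.
  by move: dmp; rewrite mulnC Gauss_dvdr // coprime_sym prime_coprime.
case=> [dm|/mapP[e em ->]]; first by rewrite dvdn_mulr.
by rewrite dvdn_pmul2r // dvdn_divisors.
Qed.

(** Strong induction on [m]: substituting ['X^p] in the factorization of ['X^m - 1] gives that of
    ['X^(m * p) - 1], whose indices pair up as [d] and [d * p]; the factors with [d != m] cancel. *)
Lemma Cyclotomic_comp_Xn (m p : nat) : prime p -> (0 < m)%N -> coprime m p ->
  'Phi_m \Po 'X^p = 'Phi_m * 'Phi_(m * p).
Proof.
move=> pp; elim/ltn_ind: m => m IH m0 mp; have p0 := prime_gt0 pp.
have nz d : 'Phi_d != 0 by apply: monic_neq0; exact: Cyclotomic_monic.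
pose D := \prod_(d <- divisors m | d != m) ('Phi_d * 'Phi_(d * p)).
have mm : m \in divisors m by rewrite divisors_id.
apply: (@mulIf _ D).
  by rewrite prodf_seq_neq0; apply/allP => d _; rewrite mulf_neq0 ?nz ?implybT.
transitivity (('X^m - 1) \Po ('X^p : {poly int})).
  rewrite -(prod_Cyclotomic m0) rmorph_prod (bigD1_seq m) ?divisors_uniq //=.
  congr (_ * _); rewrite /D big_seq_cond [RHS]big_seq_cond.
  apply: eq_bigr => d /andP[dm d_m]; rewrite IH //.
  - by rewrite ltn_neqAle d_m dvdn_leq // dvdn_divisors.
  - by move: dm; rewrite -dvdn_divisors // => /(dvdn_gt0 m0).
  - by apply: coprime_dvdl mp; rewrite dvdn_divisors.
rewrite rmorphB rmorph1 /= comp_Xn_poly -exprM mulnC.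
rewrite -(@prod_Cyclotomic (m * p)) ?muln_gt0 ?m0 //.
rewrite (perm_big _ (divisors_mul_prime pp m0 mp)) big_cat /= big_map /D big_split /=.
by rewrite mulrACA; congr (_ * _); rewrite (bigD1_seq m) ?divisors_uniq.
Qed.

(** The value is ['Phi_m(2 ^ p) / 'Phi_m(2)], at least [((2 ^ p - 1) / 3) ^ totient m], and
    [3 * p < 2 ^ p - 1] from [p = 5] on. *)
Lemma ltn_cyclotomic_value_two (m p : nat) : prime p -> (4 < p)%N ->
  (0 < m)%N -> coprime m p -> (p < cyclotomic_value (m * p) 2)%N.
Proof.
move=> pp p4 m0 mp; have p0 := prime_gt0 pp.
have NE : (cyclotomic_value m (2 ^ p) =
    cyclotomic_value m 2 * cyclotomic_value (m * p) 2)%N.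
  rewrite -abszM -hornerM -Cyclotomic_comp_Xn // horner_comp hornerXn.
  by rewrite /cyclotomic_value -[(2 ^ p)%:Z]natz natrX !natz.
have p2 : (3 * p < 2 ^ p - 1)%N.
  elim: (p) p4 => // k IH; rewrite ltnS leq_eqVlt => /predU1P[<- //|k4].
  have := IH k4.
  by rewrite expnS; lia.
have /andP[ge _] := cyclotomic_value_bounds m0 (expn_gt0 2 p).
have /andP[_ le] := cyclotomic_value_bounds m0 (isT : 0 < 2)%N.
rewrite ltnNge; apply/negP => Np.
have : ((3 * p) ^ totient m < (2 ^ p - 1) ^ totient m)%N.
  by rewrite ltn_exp2r ?totient_gt0.
rewrite ltnNge; case/negP; apply: leq_trans ge _; rewrite NE expnMn.
apply: leq_mul le (leq_trans Np _).
by rewrite -{1}[p]expn1 leq_pexp2l ?totient_gt0.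
Qed.

(** Some odd prime [p] divides [q + 1], and modulo it [q = -1] differs from 1. *)
Lemma primitive_prime_two (n q : nat) : ~ (exists e, q + 1 = 2 ^ e)%N ->
  exists p, prime p /\ 2.-primitive_root (q%:R : 'F_p).
Proof.
move=> q2.
have q1 : (0 < q + 1)%N by rewrite addn1.
have [/allP all2|] := boolP (all (pred1 2%N) (primes (q + 1))).
  case: q2; have: 2%N.-nat (q + 1)%N.
    by apply/pnatP => // l lp lq; apply: all2; rewrite mem_primes lp q1.
  by case/p_natP => e ->; exists e.
case/allPn => p; rewrite mem_primes => /and3P[pp _ pq] p2.
exists p; split=> //; have charp := pchar_Fp pp.
move: pq; rewrite (dvdn_pcharf charp) natrD addr_eq0 => /eqP ->.
have [k kp k2] : {k | k.-primitive_root (-1 : 'F_p) & (k %| 2)%N}.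
  by apply: prim_order_exists => //; rewrite sqrrN expr1n.
have k0 := prim_order_gt0 kp.
have: (k <= 2)%N by apply: dvdn_leq.
case: k k0 kp k2 => [//|[|[|//]]] _ kp _ //.
have := prim_expr_order kp; rewrite expr1 => /eqP.
rewrite eq_sym -subr_eq0 opprK -mulr2n -(dvdn_pcharf charp) dvdn_prime2 //.
by move: p2 => /= /negPf->.
Qed.

Lemma prim_order_uniq (R : nzRingType) (z : R) (m n : nat) :
  m.-primitive_root z -> n.-primitive_root z -> m = n.
Proof.
move=> mz nz; apply/eqP; rewrite eqn_dvd.
by rewrite (prim_order_dvd mz) (prim_order_dvd nz) !prim_expr_order ?eqxx.
Qed.

(** If [z] has order [o], then [z ^ p] has order [o / gcd(p, o)]; as [p] divides [n], it divides
    [o], and this order is [o / p]. *)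
Lemma prim_root_of_expr (R : nzRingType) (z : R) (n p : nat) : (p %| n)%N ->
  n.-primitive_root (z ^+ p) -> (n * p)%N.-primitive_root z.
Proof.
move=> pn zp; have n0 := prim_order_gt0 zp; have p0 := dvdn_gt0 n0 pn.
have znp : z ^+ (n * p) = 1 by rewrite mulnC exprM (prim_expr_order zp).
have [|o oz _] := prim_order_exists _ znp; first by rewrite muln_gt0 n0.
have nE := prim_order_uniq zp (exp_prim_root oz p).
have po : (p %| o)%N by apply: dvdn_trans pn _; rewrite nE dvdn_div ?dvdn_gcdr.
by rewrite nE (gcdn_idPl po) divnK.
Qed.

Theorem zsigmondy (n q : nat) : (1 < n)%N -> (1 < q)%N ->
    ~ ((exists e, q + 1 = 2 ^ e)%N /\ n = 2%N) -> ~ (q = 2%N /\ n = 6%N) ->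
  exists p, prime p /\ n.-primitive_root (q%:R : 'F_p).
Proof.
move=> n1 q1 ex2 ex6.
have [n2|n2] := leqP n 2.
  have nE : n = 2%N by apply/eqP; rewrite eqn_leq n2.
  by rewrite nE; apply: primitive_prime_two => // q2; apply: ex2.
have [|qle2] := ltnP 2 q; first exact: primitive_prime_gt2.
have {qle2 ex2} qE : q = 2%N by apply/eqP; rewrite eqn_leq qle2.
rewrite {}qE {q} in q1 ex6 *.
have [//|[p [m [k [pp nE mp1 mp NE]]]]] := primitive_prime_or_small n2 q1.
have charp := pchar_Fp pp; have m0 := prim_order_gt0 mp.
have p2 : (2 < p)%N.
  rewrite ltn_neqAle prime_gt1 // andbT; apply/eqP => pE.
  have z2 : 2%N%:R = 0 :> 'F_p by apply/eqP; rewrite -(dvdn_pcharf charp) -pE.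
  have := prim_expr_order mp; rewrite z2 expr0n eqn0Ngt m0 => /eqP.
  by rewrite eq_sym oner_eq0.
case: k nE => [|k] nE; last first.
  (* p ^ 2 divides n: an order n / p of 2 ^ p that is divisible by p forces the
     order of 2 to be n. *)
  have [||p' [pp' np']] := @primitive_prime_gt2 (m * p ^ k.+1) (2 ^ p).
  - by apply: leq_trans p2 _; rewrite expnS mulnCA leq_pmulr // muln_gt0 m0 expn_gt0 prime_gt0.
  - by rewrite -{1}[2%N]expn1 ltn_exp2l // prime_gt1.
  exists p'; split=> //; rewrite nE expnSr mulnA.
  apply: prim_root_of_expr; first by rewrite expnS mulnCA dvdn_mulr.
  by rewrite -natrX.
have mcp : coprime m p.
  rewrite coprime_sym prime_coprime //; apply/negP => pm.
  have p10 : (0 < p.-1)%N by rewrite -subn1 subn_gt0 prime_gt1.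
  by have := dvdn_leq p10 (dvdn_trans pm mp1); rewrite leqNgt ltn_predL prime_gt0.
have [p4|p4] := ltnP 4 p.
  have := ltn_cyclotomic_value_two pp p4 m0 mcp.
  by rewrite -[(m * p)%N]/(m * p ^ 1)%N -nE NE ltnn.
have pE : p = 3%N by case: p p2 p4 {NE charp mp mp1 nE mcp} pp => [|[|[|[|[|[]]]]]].
rewrite {}pE in nE mp mp1 NE.
(* Only [p = 3] is left: [m = 1] would need 2 = 1 modulo 3, and [m = 2] is the exception [n = 6]. *)
have: (m <= 2)%N by apply: dvdn_leq.
case: m m0 nE mp {mp1 mcp} => [|[|[|//]]] // _ nE mp.
  have := prim_expr_order mp; rewrite expr1 => /eqP.
  by [].
by case: ex6; rewrite nE.
Qed.

(** * Moebius inversion in the lattice of subspaces *)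

Section Lattice.

Variables (F : finFieldType) (n : nat).
Local Notation V := 'rV[F]_n.
Implicit Types (U W X Y H : {vspace V}).

Lemma card_vspace_set U : #|[set v | v \in U]| = (#|F| ^ \dim U)%N.
Proof. by rewrite cardsE card_vspace. Qed.

(* The subspaces counted are the Y + <v0 + h> with v0 \notin H fixed and h
   running through a complement of Y in H. *)
Lemma card_vspace_cap_hyperplane W H Y : (H <= W)%VS -> (Y <= H)%VS ->
    \dim W = (\dim H).+1 ->
  #|[set U : {vspace V} | [&& (U <= W)%VS, ~~ (U <= H)%VS & (U :&: H)%VS == Y]]|
    = (#|F| ^ (\dim H - \dim Y))%N.
Proof.
move=> HW YH dW.
have [v0 v0W v0H] : exists2 v, v \in W & v \notin H.
  by apply/subvPn/negP => /dimvS; rewrite dW ltnn.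
have WE : W = (H + <[v0]>)%VS.
  apply/eqP; rewrite eq_sym eqEdim subv_add HW -memvE v0W /= dW.
  rewrite (ltn_leqif (dimv_leqif_sup (addvSl H <[v0]>%VS))).
  by rewrite subv_add subvv -memvE.
have dC : \dim (H :\: Y) = (\dim H - \dim Y)%N.
  by rewrite -(dimv_cap_compl H Y) (capv_idPr YH) addKn.
rewrite -dC -card_vspace_set.
pose phi (h : V) : {vspace V} := (Y + <[v0 + h]>)%VS.
have inH h a : h \in H -> a *: (v0 + h) \in H -> a = 0.
  move=> hH; rewrite rpredZeq => /orP[/eqP//|].
  by rewrite rpredDr // (negPf v0H).
have phiH h : h \in H -> (phi h :&: H)%VS = Y.
  move=> hH; apply/eqP; rewrite eqEsubv; apply/andP; split.
    apply/subvP => x; rewrite memv_cap => /andP[/memv_addP[y yY [z]]].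
    case/vlineP => a -> -> xH.
    have avH : a *: (v0 + h) \in H by rewrite -(rpredDl _ (subvP YH y yY)).
    by rewrite (inH _ _ hH avH) scale0r addr0.
  by rewrite subv_cap YH addvSl.
rewrite -(card_in_imset (f := phi)); last first.
  move=> h h'; rewrite !inE => hC hC' eq_phi.
  have hH := subvP (diffvSl _ _) _ hC; have hH' := subvP (diffvSl _ _) _ hC'.
  apply/eqP; rewrite -subr_eq0 -memv0 -(capv_diff H Y) memv_cap.
  rewrite rpredB //= -(phiH h hH) memv_cap; apply/andP; split; last exact: rpredB.
  have -> : h - h' = (v0 + h) - (v0 + h') by rewrite opprD addrACA subrr add0r.
  by apply: rpredB; [|rewrite eq_phi]; apply: (subvP (addvSr _ _)); exact: memv_line.
congr #|pred_of_set _|; apply/setP => U; rewrite inE.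
apply/and3P/imsetP => [[UW UH /eqP UHY]|[h]].
  (* For surjectivity, a vector of [U] outside [H] is scaled to [v0] plus an element of [H], whose
     component in [Y] is then removed. *)
  have [u uU uH] := subvPn UH.
  have := subvP UW u uU; rewrite WE => /memv_addP[h1 h1H [w /vlineP[a ->] uE]].
  have a0 : a != 0.
    by apply: contraNneq uH => a0; rewrite uE a0 scale0r addr0.
  have : a^-1 *: h1 \in (Y + (H :\: Y))%VS.
    rewrite memvZ // (subvP _ _ h1H) //.
    by rewrite addvC addv_diff (addv_idPl YH).
  case/memv_addP => y yY [h hC hE].
  have hH := subvP (diffvSl _ _) _ hC.
  have YU : (Y <= U)%VS by rewrite -UHY capvSl.
  have vU : v0 + h \in U.
    have -> : v0 + h = a^-1 *: u - y.
      by rewrite uE scalerDr scalerA mulVf // scale1r hE [y + h]addrC [h + y + v0]addrAC addrK addrC.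
    by apply: rpredB; [exact: memvZ | exact: (subvP YU)].
  exists h; rewrite ?inE //; apply/eqP; rewrite eqEsubv subv_add YU -memvE vU !andbT.
  apply/subvP => x xU.
  have := subvP UW x xU; rewrite WE => /memv_addP[h2 h2H [w2 /vlineP[c ->] xE]].
  rewrite -(subrK (c *: (v0 + h)) x); apply: memv_add; last exact: memvZ (memv_line _).
  rewrite -UHY memv_cap rpredB ?memvZ //= xE scalerDr opprD addrA addrK.
  by rewrite rpredB ?memvZ.
rewrite inE => hC ->; have hH := subvP (diffvSl _ _) _ hC.
split; last by rewrite phiH.
  by rewrite subv_add (subv_trans YH HW) -memvE rpredD // (subvP HW).
apply: contra v0H; rewrite subv_add => /andP[_]; rewrite -memvE.
by rewrite rpredDr.
Qed.

Lemma exists_intermediate_vspace X W e : (X <= W)%VS ->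
    (\dim X <= e)%N -> (e <= \dim W)%N ->
  exists H : {vspace V}, [/\ (X <= H)%VS, (H <= W)%VS & \dim H = e].
Proof.
move=> XW; move kE : (e - \dim X)%N => k.
elim: k X XW kE => [|k IH] X XW kE Xe eW.
  by exists X; split=> //; apply/eqP; rewrite eqn_leq Xe -subn_eq0 kE.
have [v vW vX] : exists2 v, v \in W & v \notin X.
  by apply/subvPn/negP => /dimvS; lia.
have dXv : \dim (X + <[v]>) = (\dim X).+1.
  apply/eqP; rewrite eqn_leq; apply/andP; split.
    apply: leq_trans (dimv_add_leqif _ _) _.
    by rewrite dim_vline; case: eqP => _ /=; lia.
  rewrite (ltn_leqif (dimv_leqif_sup (addvSl X <[v]>%VS))).
  by rewrite subv_add subvv -memvE.
have [||||H [XH HW dH]] := IH (X + <[v]>)%VS; rewrite ?dXv; try lia.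
  by rewrite subv_add XW -memvE.
by exists H; split=> //; apply: subv_trans XH; exact: addvSl.
Qed.

Section Moebius.

Variable k : fieldType.
Local Notation q := (#|F|%:R : k).

(** The Moebius function of the subspace lattice on an interval of height [j], with values in
    [k]. *)
Definition moebius_vspace (j : nat) : k := (-1) ^+ j * q ^+ 'C(j, 2).

Lemma moebius_vspaceS j : moebius_vspace j.+1 = - (q ^+ j * moebius_vspace j).
Proof.
by rewrite /moebius_vspace binS bin1 exprS exprD mulN1r mulNr mulrA mulrC !mulrA.
Qed.

(* Splits the subspaces U at a hyperplane H of W containing X: those not in H
   with U :&: H = Y cancel the term of Y. *)
Lemma sum_moebius_vspace X W : (X <= W)%VS ->
  \sum_(U : {vspace V} | (X <= U)%VS && (U <= W)%VS)
     moebius_vspace (\dim W - \dim U) = (X == W)%:R.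
Proof.
move=> XW; have [->|XneW] := eqVneq X W.
  rewrite (big_pred1 W) => [|U]; last by rewrite -eqEsubv eq_sym.
  by rewrite subnn /moebius_vspace expr0 mul1r.
have ltXW : (\dim X < \dim W)%N.
  by rewrite ltn_neqAle dimvS // andbT (dimv_leqif_eq XW).
have [||H [XH HW dH]] := @exists_intermediate_vspace X W (\dim W).-1 XW; try lia.
have dW : \dim W = (\dim H).+1 by lia.
rewrite (bigID (fun U => (U <= H)%VS)) /=.
rewrite [X in _ + X](partition_big (fun U => (U :&: H)%VS)
    (fun Y => (X <= Y)%VS && (Y <= H)%VS)) /=; last first.
  by move=> U /andP[/andP[XU UW] UH]; rewrite subv_cap XU XH capvSr.
rewrite (eq_bigl (fun U => (X <= U)%VS && (U <= H)%VS)); last first.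
  move=> U; case: (boolP (U <= H)%VS) => UH; rewrite ?andbF // !andbT.
  by rewrite (subv_trans UH HW) andbT.
rewrite -big_split /= big1 // => Y /andP[XY YH].
rewrite (eq_big (fun U => [&& (U <= W)%VS, ~~ (U <= H)%VS & (U :&: H)%VS == Y])
    (fun=> moebius_vspace (\dim H - \dim Y))); first last.
- move=> U /andP[/andP[/andP[XU UW] UH] /eqP UHY].
  have UHW : (U + H)%VS = W.
    apply/eqP; rewrite eqEdim subv_add UW HW dW.
    rewrite (ltn_leqif (dimv_leqif_sup (addvSr U H))).
    by rewrite /= subv_add subvv andbT.
  have := dimv_sum_cap U H; rewrite UHW UHY dW => dU.
  congr moebius_vspace; have := dimvS YH; lia.
- move=> U; case: eqP => [UHY|]; rewrite ?andbF // !andbT.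
  by have -> : (X <= U)%VS by rewrite (subv_trans XY) // -UHY capvSl.
rewrite sumr_const -cardsE card_vspace_cap_hyperplane //.
have -> : (\dim W - \dim Y = (\dim H - \dim Y).+1)%N by have := dimvS YH; lia.
by rewrite moebius_vspaceS -[_ *+ (_ ^ _)]mulr_natl natrX addNr.
Qed.

Definition zeta_vspace (c : {vspace V} -> k) U : k := \sum_(M | (M <= U)%VS) c M.

(** Sum [zeta_vspace c U] against the Moebius function over [X <= U <= W]. Exchanging sums leaves
    only [c M] with [X + M = W], all 0; directly, only [U = X] remains, with coefficient a signed
    power of [q], hence nonzero. *)
Lemma zeta_vspace_eq0 (c : {vspace V} -> k) X W : q != 0 -> (X <= W)%VS ->
    (forall M, (W <= X + M)%VS -> c M = 0) ->
    (forall U, (X <= U)%VS -> (U <= W)%VS -> U != X -> zeta_vspace c U = 0) ->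
  zeta_vspace c X = 0.
Proof.
move=> q0 XW cW zU.
have : \sum_(U : {vspace V} | (X <= U)%VS && (U <= W)%VS)
   moebius_vspace (\dim W - \dim U) * zeta_vspace c U = 0.
  under eq_bigr do rewrite mulr_sumr.
  rewrite (exchange_big_dep (fun M => (M <= W)%VS)) /=; last first.
    by move=> U M /andP[_ UW] /subv_trans; apply.
  apply: big1 => M MW; rewrite -mulr_suml.
  rewrite (eq_bigl (fun U => (X + M <= U)%VS && (U <= W)%VS)); last first.
    by move=> U; rewrite subv_add andbAC.
  rewrite sum_moebius_vspace ?subv_add ?XW //.
  by case: eqP => [XMW|_]; rewrite ?mul0r // cW ?mulr0 // XMW subvv.
rewrite (bigD1 X) ?subvv //= big1 ?addr0; last first.
  by move=> U /andP[/andP[XU UW] UX]; rewrite zU ?mulr0.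
by move/eqP; rewrite mulf_eq0 /moebius_vspace mulf_eq0 signr_eq0 expf_eq0 (negPf q0) andbF => /eqP.
Qed.

Lemma zeta_vspace_window_eq0 (c : {vspace V} -> k) (d t : nat) : q != 0 ->
    (t + d <= n)%N -> (forall M, (d < \dim M)%N -> c M = 0) ->
    (forall U, (t <= \dim U)%N -> (\dim U <= t + d)%N -> zeta_vspace c U = 0) ->
  forall M, c M = 0.
Proof.
move=> q0 tdn cd zt.
(* Downward propagation: [j] bounds how far [\dim U] lies below [t]. *)
have z0 : forall j U, (t <= \dim U + j)%N -> (\dim U <= t + d)%N ->
    zeta_vspace c U = 0.
  elim=> [|j IH] U; first by rewrite addn0; exact: zt.
  have [tU _|tU jt dU] := leqP t (\dim U + j); first exact: IH.
  have dn : \dim (fullv : {vspace V}) = n by rewrite dimvf /dim /= mul1n.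
  (* With this dimension, [W <= U + M] forces [\dim M > d], while every subspace of [W] has
     dimension at most [t + d]. *)
  have [||W [UW _ dW]] := @exists_intermediate_vspace U fullv (\dim U + d.+1) (subvf U).
  - by rewrite leq_addr.
  - by rewrite dn; lia.
  apply: (zeta_vspace_eq0 q0 UW) => [M WM|U' UU' U'W U'U].
    apply: cd; have := leq_trans (dimvS WM) (dimv_add_leqif U M); lia.
  have ltU : (\dim U < \dim U')%N.
    by rewrite ltn_neqAle dimvS // andbT (dimv_leqif_eq UU') eq_sym.
  by apply: IH; have := dimvS U'W; lia.
(* The zeta transform now vanishes up to dimension [t + d], which covers the support of [c];
   induction on the dimension recovers [c]. *)
move=> M; move: {2}(\dim M).+1 (ltnSn (\dim M)) => e.
elim: e M => // e IH M Me.
have [dM|Md] := ltnP d (\dim M); first exact: cd.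
have [tM|Mt] := leqP (\dim M) (t + d); last by lia.
have := z0 t M (leq_addl _ _) tM.
rewrite /zeta_vspace (bigD1 M) ?subvv //= big1 ?addr0 // => N /andP[NM NneM].
apply: IH; rewrite -ltnS; apply: leq_trans Me.
by rewrite ltnS ltn_neqAle dimvS // andbT (dimv_leqif_eq NM).
Qed.

End Moebius.
End Lattice.

(** * The polynomial method *)

Section SpanVspace.

Variables (F : finFieldType) (n : nat) (k : fieldType).
Local Notation V := 'rV[F]_n.
Local Notation q := (#|F|%:R : k).
Implicit Types (U W M : {vspace V}) (f g : {vspace V} -> k).

(* Functions U |-> \sum_M c M * (M <= U)%:R with c supported in dimension at most
   e; they play the role of the polynomials of degree at most e. *)
Definition in_span_vspace (e : nat) f : Prop :=
  exists2 c : {vspace V} -> k, (forall M, (e < \dim M)%N -> c M = 0)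
    & f =1 zeta_vspace c.

Lemma in_span_vspace_le e e' f : (e <= e')%N ->
  in_span_vspace e f -> in_span_vspace e' f.
Proof.
move=> le_e [c c0 fE]; exists c => // M e'M.
by apply: c0; apply: leq_ltn_trans e'M.
Qed.

Lemma in_span_vspace_indicator M :
  in_span_vspace (\dim M) (fun U => (M <= U)%VS%:R).
Proof.
exists (fun N => (N == M)%:R) => [N|U].
  by case: eqP => // ->; rewrite ltnn.
rewrite /zeta_vspace big_mkcond (bigD1 M) //= eqxx big1 ?addr0; last first.
  by move=> N /negPf->; rewrite if_same.
by case: ifP.
Qed.

(** The indicators of [M <= U] and [N <= U] multiply to that of [M + N <= U], and dimension is
    subadditive. *)
Lemma in_span_vspaceM e e' f g : in_span_vspace e f -> in_span_vspace e' g ->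
  in_span_vspace (e + e') (fun U => f U * g U).
Proof.
move=> [c c0 fE] [c' c'0 gE].
exists (fun P => \sum_(p : {vspace V} * {vspace V} | (p.1 + p.2)%VS == P)
                    c p.1 * c' p.2).
  move=> P eP; apply: big1 => -[M N] /= /eqP MN; rewrite -MN in eP.
  have := leq_trans eP (dimv_add_leqif M N).
  have [eM _|Me eN] := ltnP e (\dim M); first by rewrite c0 ?mul0r.
  by rewrite c'0 ?mulr0 //; lia.
move=> U; rewrite fE gE /zeta_vspace big_distrl /=.
under eq_bigr do rewrite big_distrr /=.
rewrite pair_big /=.
rewrite (partition_big (fun p => (p.1 + p.2)%VS) (fun P => (P <= U)%VS)) /=.
  apply: eq_bigr => P PU; apply: eq_bigl => -[M N] /=.
  by case: eqP => [MN|]; rewrite ?andbF // andbT -subv_add MN.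
by move=> [M N] /= ; rewrite subv_add.
Qed.

(** The power counts the vectors of [W] lying in [U]; grouped by their span they give indicators of
    dimension at most 1. The constant [a] is charged to the zero subspace. *)
Lemma in_span_vspace_expr W (a : k) :
  in_span_vspace 1 (fun U => q ^+ \dim (U :&: W)%VS - a).
Proof.
exists (fun M => \sum_(v in W | <[v]>%VS == M) 1 - a * (M == 0%VS)%:R).
  move=> M M1; rewrite big_pred0 ?sub0r; last first.
    move=> v; apply/negP => /andP[_ /eqP vM]; move: M1.
    by rewrite -vM dim_vline; case: eqP.
  by case: eqP M1 => [->|_ _]; rewrite ?dimv0 // mulr0 oppr0.
move=> U; rewrite /zeta_vspace big_split /=; congr (_ + _); last first.
  rewrite (bigD1 0%VS) ?sub0v //= eqxx mulr1 big1 ?addr0 // => M /andP[_ /negPf->].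
  by rewrite mulr0 oppr0.
transitivity (\sum_(v in (U :&: W)%VS) (1 : k)).
  by rewrite sumr_const card_vspace natrX.
rewrite (partition_big (fun v : V => <[v]>%VS) (fun M => (M <= U)%VS)) /=; last first.
  by move=> v; rewrite memv_cap memvE => /andP[].
apply: eq_bigr => M MU; apply: eq_bigl => v.
case: eqP => [vM|]; rewrite ?andbF // !andbT memv_cap.
by rewrite memvE vM MU.
Qed.

Lemma in_span_vspace_prod (I : finType) (A : {set I}) (f : I -> {vspace V} -> k) :
    (forall i, in_span_vspace 1 (f i)) ->
  in_span_vspace #|A| (fun U => \prod_(i in A) f i U).
Proof.
move=> f1.
suff [c c0 cE] : in_span_vspace #|A| (fun U => \prod_(i <- enum A) f i U).
  by exists c => // U; rewrite -cE big_enum.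
rewrite cardE; elim: (enum A) => [|i s IH].
  have [c c0 cE] := in_span_vspace_indicator 0%VS; rewrite dimv0 in c0.
  by exists c => // U; rewrite big_nil -cE sub0v.
have [c c0 cE] := in_span_vspaceM (f1 i) IH.
by exists c => // U; rewrite big_cons -cE.
Qed.

End SpanVspace.

(** The coordinate matrix of the [phi i] is row free, since a relation among its rows is one among
    the [phi i]; so its rank [#|A|] is at most [#|B|]. *)
Lemma leq_card_independent (k : fieldType) (I J : finType) (T : Type)
    (A : {set I}) (B : {set J}) (phi : I -> T -> k) (x : J -> T -> k)
    (c : I -> J -> k) :
    (forall i t, i \in A -> phi i t = \sum_(j in B) c i j * x j t) ->
    (forall a : I -> k, (forall t, \sum_(i in A) a i * phi i t = 0) ->
       forall i, i \in A -> a i = 0) ->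
  (#|A| <= #|B|)%N.
Proof.
move=> phiE free.
pose C := \matrix_(i < #|A|, j < #|B|) c (enum_val i) (enum_val j).
suff /eqP <- : row_free C by exact: rank_leq_col.
rewrite -kermx_eq0; apply/rowV0P => v /sub_kermxP vC.
pose a i := \sum_(i' | enum_val i' == i) v 0 i'.
have aE i' : a (enum_val i') = v 0 i'.
  rewrite /a (big_pred1 i') // => j; apply/eqP/eqP => [|-> //].
  exact: enum_val_inj.
apply/rowP => i'; rewrite mxE -aE; apply: free (enum_valP i') => t.
rewrite big_enum_val /=.
transitivity (\sum_(j < #|B|) (v *m C) 0 j * x (enum_val j) t); last first.
  by rewrite vC big1 // => j _; rewrite mxE mul0r.
under [RHS]eq_bigr do rewrite mxE mulr_suml.
rewrite exchange_big /=; apply: eq_bigr => i _.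
rewrite aE phiE ?enum_valP // big_enum_val mulr_sumr.
by apply: eq_bigr => j _; rewrite mxE mulrA.
Qed.

(* Some window of d + 1 residues avoids K since each k in K meets d + 1 of the b
   windows. If that window ends beyond n, it can be moved down to start right
   after the largest element of K. *)
Lemma exists_free_window (b n d : nat) (K : {set 'I_b}) :
    (#|K| * d.+1 < b)%N -> (d + #|K| + \max_(k in K) (k : nat) <= n)%N ->
  exists2 t, (t + d <= n)%N &
    forall m (k : 'I_b), (t <= m <= t + d)%N -> k \in K -> m <> k %[mod b].
Proof.
move=> Kd maxn; have b0 : (0 < b)%N by apply: leq_ltn_trans Kd.
have [K0|K0] := eqVneq #|K| 0%N.
  exists 0%N => [|m k _]; first by lia.
  by rewrite (cards0_eq K0) inE.
pose res m : 'I_b := Ordinal (ltn_pmod m b0).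
have [t0 /forallP free0] :
    exists t0 : 'I_b, [forall i : 'I_d.+1, res (t0 + i)%N \notin K].
  apply/existsP; apply: contraTT Kd; rewrite negb_exists -leqNgt => /forallP hit.
  have {}hit (t : 'I_b) : exists i : 'I_d.+1, res (t + i)%N \in K.
    by have := hit t; rewrite negb_forall => /existsP[i]; rewrite negbK; exists i.
  have [g gK] := fin_all_exists hit.
  pose f (t : 'I_b) := (res (t + g t)%N, g t).
  have f_inj : injective f.
    move=> t t' [tt' eqg]; apply/val_inj/eqP => /=; move/eqP: tt'.
    by rewrite eqg eqn_modDr !modn_small.
  apply: (@leq_trans #|f @: predT|); first by rewrite card_imset // card_ord.
  apply: (@leq_trans #|setX K [set: 'I_d.+1]|); last first.
    by rewrite cardsX cardsT card_ord.
  by apply/subset_leq_card/subsetP => _ /imsetP[t _ ->]; rewrite !inE gK.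
have {}free0 m (k : 'I_b) : (t0 <= m <= t0 + d)%N -> k \in K -> m <> k %[mod b].
  move=> /andP[tm mt] kK mk; have id : (m - t0 < d.+1)%N by lia.
  have := free0 (Ordinal id); rewrite /= subnKC //.
  suff -> : res m = k by rewrite kK.
  by apply: val_inj; rewrite /= mk modn_small.
have [tn|nt] := leqP (t0 + d) n; first by exists t0.
(* As [K] is nonempty, the new window ends within [n]. Below [b], a match with [k] would mean
   [m = k <= kmax]; from [b] on, [m] lies in the old window because [n < t0 + d]. *)
set kmax := \max_(k in K) _ in maxn; exists kmax.+1 => [|m k]; first by lia.
move=> /andP[km mk] kK mkE.
have kk : (k <= kmax)%N by exact: (@leq_bigmax_cond _ (mem K) (fun k : 'I_b => k : nat)).
have [mb|bm] := ltnP m b.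
  by move: mkE; rewrite !modn_small //; lia.
by apply: (free0 m k) => //; have := ltn_ord t0; lia.
Qed.

(** Powers of a primitive root agree exactly when their exponents agree modulo [b]. *)
Lemma mod_inE (k : fieldType) (b : nat) (z : k) (A : {set 'I_b}) (d : nat) :
    b.-primitive_root z ->
  mod_in A d <-> \prod_(i in A) (z ^+ d - z ^+ i) = 0.
Proof.
move=> zb; split=> [[i iA di]|/eqP].
  rewrite (bigD1 i) //=.
  have /eqP -> : z ^+ d == z ^+ i by rewrite (eq_prim_root_expr zb); apply/eqP.
  by rewrite subrr mul0r.
rewrite prodf_seq_eq0 => /hasP[i _ /andP[iA]].
by rewrite subr_eq0 (eq_prim_root_expr zb) => /eqP di; exists i.
Qed.

(** * Independence of the functions attached to the family *)

Section IntersectingFamily.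

Variables (F : finFieldType) (n : nat) (k : fieldType) (b : nat).
Local Notation V := 'rV[F]_n.
Local Notation q := (#|F|%:R : k).
Variables (K L : {set 'I_b}) (Fam : {set {vspace V}}).

Hypothesis q_b : b.-primitive_root q.
Hypothesis KL : [disjoint K & L].
Hypothesis dim_Fam : forall U, U \in Fam -> mod_in K (\dim U).
Hypothesis cap_Fam : forall U W, U \in Fam -> W \in Fam -> U != W ->
  mod_in L (\dim (U :&: W)%VS).
Hypothesis Kn : (#|L| + \max_(i in K) (i : nat) <= n)%N.
Hypothesis KLb : (#|L| < #|K|)%N \/ (#|K| * (#|L| - #|K|).+1 < b)%N.

Lemma card_family_add_le :
  (#|Fam| + #|[set M : {vspace V} | (\dim M + #|K| <= #|L|)%N]|
     <= #|[set M : {vspace V} | (\dim M <= #|L|)%N]|)%N.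
Proof.
(* Left summands index the functions of the family, right summands the [g_M]; the additive form of
   the condition avoids truncated subtraction. *)
pose A : {set {vspace V} + {vspace V}} := [set i | match i with
  | inl W => W \in Fam
  | inr M => (\dim M + #|K| <= #|L|)%N end].
pose prodK (U : {vspace V}) : k := \prod_(i in K) (q ^+ \dim U - q ^+ i).
pose phi (i : {vspace V} + {vspace V}) (U : {vspace V}) : k := match i with
  | inl W => \prod_(l in L) (q ^+ \dim (U :&: W)%VS - q ^+ l)
  | inr M => (M <= U)%VS%:R * prodK U end.
have inl_A W : (inl W \in A) = (W \in Fam) by rewrite inE.
have inr_A M : (inr M \in A) = (\dim M + #|K| <= #|L|)%N by rewrite inE.
have cardA : #|A| = (#|Fam| + #|[set M : {vspace V} | (\dim M + #|K| <= #|L|)%N]|)%N.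
  rewrite -[#|A|]sum1_card big_sumType /=.
  by congr (_ + _)%N; rewrite -[RHS]sum1_card; apply: eq_bigl => M;
    rewrite ?inl_A ?inr_A ?inE.
rewrite -cardA.
have prodKP : in_span_vspace #|K| prodK.
  apply: (@in_span_vspace_prod F n k 'I_b K (fun i U => q ^+ \dim U - q ^+ i)) => i.
  have [c c0 cE] := in_span_vspace_expr (fullv : {vspace V}) (q ^+ i : k).
  by exists c => // U; rewrite -cE capvf.
have [c cP] : exists c : {vspace V} + {vspace V} -> {vspace V} -> k,
    forall i, i \in A -> (forall M, (#|L| < \dim M)%N -> c i M = 0) /\
      phi i =1 zeta_vspace (c i).
  apply: (@fin_all_exists _ (fun=> {vspace V} -> k)
    (fun i ci => i \in A -> (forall M, (#|L| < \dim M)%N -> ci M = 0) /\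
       phi i =1 zeta_vspace ci)) => i.
  have [iA|iA] := boolP (i \in A); last by exists (fun=> 0).
  suff [c c0 cE] : in_span_vspace #|L| (phi i) by exists c.
  case: i iA => [W _|M]; rewrite ?inr_A.
    by apply: in_span_vspace_prod => l; exact: in_span_vspace_expr.
  move=> dM; apply: in_span_vspace_le dM _.
  exact: (in_span_vspaceM (in_span_vspace_indicator k M) prodKP).
apply: (@leq_card_independent k _ _ _ A _ phi (fun M U => (M <= U)%VS%:R) c).
  move=> i U iA; have [c0 ->] := cP i iA.
  rewrite /zeta_vspace big_mkcond [RHS]big_mkcond; apply: eq_bigr => M _.
  rewrite inE; have [dM|dM] := leqP (\dim M) #|L|.
    by case: ifP; rewrite ?mulr1 ?mulr0.
  by rewrite c0 // if_same.
move=> a sum0.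
(* Evaluating the relation at [W] leaves only its own term, whose product is nonzero because
   [\dim W] has its residue in [K], which is disjoint from [L]. *)
have a0 W : W \in Fam -> a (inl W) = 0.
  move=> WF; have := sum0 W; rewrite big_sumType /=.
  rewrite (bigD1 W) ?inl_A //= [X in _ + X + _ = 0]big1 => [|U]; last first.
    rewrite inl_A => /andP[UF UW].
    by rewrite (proj1 (mod_inE _ _ q_b)) ?mulr0 //; apply: cap_Fam; rewrite // eq_sym.
  rewrite [X in _ + X = 0]big1 => [|M _]; last first.
    by rewrite /prodK (proj1 (mod_inE _ _ q_b)) ?mulr0 //; exact: dim_Fam.
  rewrite !addr0 capvv => /eqP; rewrite mulf_eq0 => /orP[/eqP//|/eqP].
  move/(mod_inE _ _ q_b) => [l lL Wl]; have [i iK Wi] := dim_Fam WF.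
  have il : i = l by apply: val_inj; rewrite /= -(modn_small (ltn_ord i)) -Wi Wl modn_small.
  by have := disjointFr KL iK; rewrite il lL.
case=> [W|M iA]; rewrite ?inl_A; first exact: a0.
(* If [#|L| < #|K|] there are no [g_M] at all. *)
case: KLb => [LK|KLb']; first by move: iA; rewrite inr_A; lia.
have leKL : (#|K| <= #|L|)%N by move: iA; rewrite inr_A; lia.
have [|t tn tK] := @exists_free_window b n (#|L| - #|K|) K KLb'; first by rewrite subnK.
pose c' N : k := if (\dim N + #|K| <= #|L|)%N then a (inr N) else 0.
suff c'0 : forall N, c' N = 0 by have := c'0 M; move: iA; rewrite inr_A /c' => ->.
have b0 := prim_order_gt0 q_b.
have q0 : q != 0.
  apply/eqP => q0; have := prim_expr_order q_b.
  by rewrite q0 expr0n eqn0Ngt b0 => /eqP; rewrite eq_sym oner_eq0.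
apply: (zeta_vspace_window_eq0 q0 tn) => [N dN|U tU Ut].
  by rewrite /c'; case: ifP => //; lia.
(* At [U] the relation reads [zeta_vspace c' U * prodK U = 0], and [prodK U] is nonzero throughout
   the window. *)
have := sum0 U; rewrite big_sumType /= big1 ?add0r; last first.
  by move=> W; rewrite inl_A => WF; rewrite a0 ?mul0r.
under eq_bigr do rewrite mulrA.
rewrite -mulr_suml => /eqP; rewrite mulf_eq0 => /orP[/eqP sumU|/eqP].
  rewrite -[RHS]sumU /zeta_vspace big_mkcond [RHS]big_mkcond.
  apply: eq_bigr => N _; rewrite inr_A /c'.
  by do 2!case: ifP => _; rewrite ?mulr1 ?mulr0.
by move/(mod_inE _ _ q_b) => [i iK Ui]; case: (tK _ i _ iK Ui); rewrite tU.
Qed.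

End IntersectingFamily.

(** Each step of the induction on [r] splits off the dimension [s - r]; once [r] exceeds [s], the
    index is negative and the term is 0. *)
Lemma card_dim_window_le (F : finFieldType) (n s r : nat) :
  (#|[set M : {vspace 'rV[F]_n} | (\dim M <= s)%N]|
     <= #|[set M : {vspace 'rV[F]_n} | (\dim M + r <= s)%N]| + Nqsum F n s r)%N.
Proof.
rewrite /Nqsum; elim: r => [|r IH].
  rewrite big_ord0 addn0; apply: subset_leq_card; apply/subsetP => M.
  by rewrite !inE addn0.
apply: leq_trans IH _; rewrite big_ord_recr /= addnC [leqRHS]addnC -addnA leq_add2l.
apply: leq_trans (subset_leq_card _) (leq_card_setU _ _).
apply/subsetP => M; rewrite !inE => dM.
have [sM|sM] := eqVneq (\dim M + r)%N s; apply/orP; [left|right].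
  by rewrite -sM PoszD addrK.
by lia.
Qed.

(** * Passage to coordinates and the final bound *)

Section Embedding.

Import VectorInternalTheory.

Lemma linear_embedding_rV (F : fieldType) (V : vectType F) :
  exists f : 'Hom(V, 'rV[F]_(\dim {:V})), lker f == 0%VS.
Proof.
rewrite dimvf; exists (linfun (@v2r F V)); apply/lker0P => x y; rewrite !lfunE.
exact: v2r_inj.
Qed.

End Embedding.

Unset Implicit Arguments.

Theorem mainTheorem8
  (F : finFieldType) (q : nat) (hq : #|F| = q)
  (V : vectType F) (n : nat) (hn : \dim {:V} = n)
  (b r s : nat) (K L : {set 'I_b})
  (hK : #|K| = r) (hL : #|L| = s) (hKL : [disjoint K & L])
  (hsk : (s + \max_(k in K) (k : nat) <= n)%N)
  (hrs : r%:Z * (s%:Z - r%:Z + 1) <= b%:Z - 1)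
  (Fam : {set {vspace V}})
  (hdim : forall U, U \in Fam -> mod_in K (\dim U))
  (hcap : forall U W, U \in Fam -> W \in Fam -> U != W ->
            mod_in L (\dim (U :&: W)%VS))
  (hi : ~ ((exists e : nat, (q + 1 = 2 ^ e)%N) /\ b = 2%N))
  (hii : ~ (q = 2%N /\ b = 6%N)) :
  (#|Fam| <= Nqsum F n s r)%N.

Proof.
subst q r s; have [b1|b2] := leqP b 1.
  (* For [b = 0], [K] would be empty and [hrs] would read [0 <= -1]. *)
  have b0 : (0 < b)%N.
    have Kb : (#|K| <= b)%N by apply: leq_trans (max_card _) _; rewrite card_ord.
    rewrite lt0n; apply/negP => /eqP b0; have K0 : #|K| = 0%N by lia.
    by move: hrs; rewrite K0 mul0r; lia.
  have bE : b = 1%N by lia.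
  (* For [b = 1], a nonempty [K] is all of ['I_1], so [L] is empty and the family has at most one
     member; the zero subspace makes the bound at least 1. *)
  have [K0|/set0Pn[k kK]] := eqVneq K set0.
    suff -> : Fam = set0 by rewrite cards0.
    apply/setP => U; rewrite inE; apply/negP => /hdim[k].
    by rewrite K0 inE.
  have L0 : L = set0.
    apply/setP => l; rewrite inE; apply: contraTF kK => lL.
    have -> : k = l by apply: val_inj => /=; move: (ltn_ord k) (ltn_ord l); lia.
    by rewrite (disjointFl hKL).
  rewrite L0 cards0 in hsk *.
  apply: (@leq_trans 1).
    apply/card_le1_eqP => U W UF WF; apply/eqP; apply: contraT => UW.
    by have [l] := hcap _ _ WF UF UW; rewrite L0 inE.
  have K0 : (0 < #|K|)%N by apply/card_gt0P; exists k.
  rewrite /Nqsum; case: #|K| K0 => // r _; rewrite big_ord_recl.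
  apply: leq_trans (leq_addr _ _); apply/card_gt0P; exists 0%VS.
  by rewrite inE dimv0.
have [p [pp qb]] := zsigmondy b2 (finNzRing_gt1 F) hi hii.
have [f fK] := linear_embedding_rV V; rewrite hn in f fK.
have f_inj : injective (fun U : {vspace V} => (f @: U)%VS).
  apply: (can_inj (g := fun U => (f^-1 @: U)%VS)) => U.
  by rewrite -limg_comp lker0_compVf // lim1g.
have f_dim (U : {vspace V}) : \dim (f @: U) = \dim U.
  by apply: limg_dim_eq; rewrite (eqP fK) capv0.
rewrite -(card_imset _ f_inj).
rewrite -(leq_add2r #|[set M : {vspace 'rV[F]_n} | (\dim M + #|K| <= #|L|)%N]|).
apply: (@leq_trans #|[set M : {vspace 'rV[F]_n} | (\dim M <= #|L|)%N]|); last first.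
  by rewrite addnC; exact: card_dim_window_le.
apply: (card_family_add_le qb hKL) => //.
- by move=> _ /imsetP[U UF ->]; rewrite f_dim; exact: hdim.
- move=> _ _ /imsetP[U UF ->] /imsetP[W WF ->] fUW.
  rewrite -lker0_img_cap // f_dim; apply: hcap => //.
  by apply: contraNneq fUW => ->.
(* Natural subtraction matches the integer factor [s - r + 1] of [hrs] only when [r <= s]. *)
have [|KL] := ltnP #|L| #|K|; [by left|right].
move: hrs; have <- : (#|L| - #|K|).+1%:Z = #|L|%:Z - #|K|%:Z + 1 by lia.
by rewrite -PoszM; move: (_ * _)%N => m; lia.
Qed.
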